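(* Let $k\ge 1$ be an integer. If $D\in D(k,k)$ is acyclic and has $m$ edges, then $D$ contains a directed cut of size at least $\left(\frac14+\frac{1}{8k+4}\right)m$.
   Context: All digraphs are finite, without loops and without parallel edges; acyclic means having no directed cycle. For integers $k,\ell\ge 0$, $D(k,\ell)$ denotes the family of digraphs in which every vertex $v$ satisfies $d^-(v)\le k$ or $d^+(v)\le \ell$. A directed cut of a digraph $D$ is a set of edges of the form $\{xy\in E(D): x\in X, y\in Y\}$ for some partition $X,Y$ of $V(D)$; its size is its cardinality. *)

(* Defs.v *)
From mathcomp Require Import all_boot all_order all_algebra.

Set Implicit Arguments.
Unset Strict Implicit.
Unset Printing Implicit Defensive.

(* A finite digraph is a relation [e] on a finite type of vertices: [e x y]
   means that xy is an edge.  Parallel edges are thereby excluded; absence of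
   loops is the separate hypothesis [irreflexive e]. *)

Definition edges (V : finType) (e : rel V) : {set V * V} :=
  [set p | e p.1 p.2].

Definition indeg (V : finType) (e : rel V) (v : V) : nat :=
  #|[set u | e u v]|.

Definition outdeg (V : finType) (e : rel V) (v : V) : nat :=
  #|[set w | e v w]|.

Definition in_Dfam (k l : nat) (V : finType) (e : rel V) : Prop :=
  forall v : V, indeg e v <= k \/ outdeg e v <= l.

(* [ucycle e [::]] holds in MathComp, hence the restriction to nonempty [c]. *)
Definition acyclic (V : finType) (e : rel V) : Prop :=
  forall c : seq V, c != [::] -> ~ ucycle e c.

(* One of the two parts may be empty. *)
Definition directed_cut (V : finType) (e : rel V) (C : {set V * V}) : Prop :=
  exists X Y : {set V},
    [/\ X :|: Y = [set: V], [disjoint X & Y]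
      & C = [set p in edges e | (p.1 \in X) && (p.2 \in Y)]].

(* Main.v *)
Require Import Defs.
From mathcomp Require Import all_boot all_order all_algebra.
From mathcomp Require Import zify ring lra.
Set Implicit Arguments.
Unset Strict Implicit.
Unset Printing Implicit Defensive.
Import Order.TTheory GRing.Theory Num.Theory.
Local Open Scope ring_scope.

(** The vertices of in-degree at most k induce a digraph which, being acyclic,
    can be coloured greedily with k+1 colours, from the sources on; the
    remaining vertices have out-degree at most k and are coloured with k+1
    further colours, from the sinks on.  For a uniformly random set S of k+1 of
    these 2k+2 colours, an edge goes from a colour in S to a colour outside S
    with probability C(2k,k)/C(2k+2,k+1) = (k+1)/(4k+2) = 1/4 + 1/(8k+4). *)

(** The number of reachable vertices serves as a height for the greedy colouring. It drops strictly
    along [u v], since a path from [v] back to [u] would close a directed cycle. *)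
Lemma card_connect_ltn (V : finType) (e : rel V) (u v : V) :
  acyclic e -> e u v -> (#|connect e v| < #|connect e u|)%N.
Proof.
move=> acyc euv; apply: proper_card; apply/properP; split.
  by apply/subsetP => x; apply: connect_trans; apply: connect1.
exists u; first exact: connect0.
apply/negP => /connectP [p0 /shortenP [p pthp unip _] lastp].
apply: (acyc (v :: p)) => //.
by rewrite /ucycle unip /= rcons_path pthp -lastp euv.
Qed.

(** Colouring by increasing [h], the in-neighbours of a vertex come first, and for a vertex of [A]
    they block at most [k] of the [k.+1] colours. *)
Lemma greedy_coloring (V : finType) (e : rel V) (h : V -> nat) (A : {pred V})
    (k : nat) :
  (forall u v, e u v -> (h u < h v)%N) ->
  {in A, forall v, (indeg e v <= k)%N} ->
  exists f : V -> 'I_k.+1, {in A, forall v u, e u v -> f u != f v}.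
Proof.
move=> hlt degA.
suff H n : exists f : V -> 'I_k.+1,
    {in A, forall v, (h v < n)%N -> forall u, e u v -> f u != f v}.
  have [f fP] := H (\max_v h v).+1.
  by exists f => v Av; apply: fP; rewrite // ltnS leq_bigmax.
elim: n => [|n [f fP]]; first by exists (fun=> ord0).
pose free v c := c \notin f @: [set u | e u v].
(* Only level [n] is recoloured. The default [ord0] can occur only outside [A], where nothing is
   claimed. *)
pose g v := if h v == n then odflt ord0 [pick c | free v c] else f v.
exists g => v Av; rewrite ltnS => hvn u euv.
have hu : (h u == n) = false by have := hlt _ _ euv; lia.
rewrite /g hu; case: (altP (h v =P n)) => [_|hv]; last by apply: fP => //; lia.
case: pickP => [c freec|nofree] /=.
  by apply: contraNneq freec => <-; rewrite imset_f ?inE.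
have : (#|'I_k.+1| <= k)%N.
  apply: leq_trans (degA v Av); apply: leq_trans (leq_imset_card f _).
  by apply/subset_leq_card/subsetP => c _; move/negbFE: (nofree c).
by rewrite card_ord ltnn.
Qed.

Lemma proper_coloring (k : nat) (V : finType) (e : rel V) :
  in_Dfam k k e -> acyclic e ->
  exists f : V -> 'I_k.+1 + 'I_k.+1, forall u v, e u v -> f u != f v.
Proof.
move=> hD acyc; pose A := [pred v | (indeg e v <= k)%N].
have [||f fP] := @greedy_coloring V e (fun v => #|V| - #|connect e v|)%N A k.
- move=> u v /(card_connect_ltn acyc) lt_vu.
  by apply: ltn_sub2l => //; apply: leq_trans lt_vu (max_card _).
- by [].
(* In the reversed digraph, in-degrees are the out-degrees of [e], and the height itself increases
   along edges. *)
have [||g gP] := @greedy_coloring V (fun u v => e v u)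
  (fun v => #|connect e v|) [predC A] k.
- by move=> u v; apply: card_connect_ltn.
- by move=> v; rewrite !inE => nAv; case: (hD v) => // h; rewrite h in nAv.
exists (fun v => if v \in A then inl (f v) else inr (g v)) => u v euv.
case: (boolP (u \in A)) => Au; case: (boolP (v \in A)) => Av //.
- by apply: contra (fP _ Av _ euv) => /eqP [->].
- by rewrite eq_sym; apply: contra (gP _ Au _ euv) => /eqP [->].
Qed.

(** Adding [a] to the [k]-subsets avoiding [a] and [b] is injective. *)
Lemma card_separating_sets (T : finType) (a b : T) (k : nat) :
  a != b ->
  ('C(#|T| - 2, k) <=
     #|[set S : {set T} | [&& #|S| == k.+1, a \in S & b \notin S]]|)%N.
Proof.
move=> ab.
have <- : #|~: [set a; b]| = (#|T| - 2)%N by rewrite cardsCs setCK cards2 ab.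
rewrite -cards_draws -(@card_in_imset _ _ (fun S => a |: S)).
  apply/subset_leq_card/subsetP => _ /imsetP [S + ->].
  rewrite !inE => /andP [/subsetP sub /eqP cS].
  have na : a \notin S by apply/negP => /sub; rewrite !inE eqxx.
  have nb : b \notin S by apply/negP => /sub; rewrite !inE eqxx orbT.
  by rewrite cardsU1 na cS !eqxx [b == a]eq_sym negb_or ab.
move=> S S'; rewrite !inE => /andP [/subsetP sub _] /andP [/subsetP sub' _] eqS.
have na : a \notin S by apply/negP => /sub; rewrite !inE eqxx.
have na' : a \notin S' by apply/negP => /sub'; rewrite !inE eqxx.
by rewrite -(setU1K na) eqS setU1K.
Qed.

Lemma average_cut (V T : finType) (e : rel V) (f : V -> T) (k : nat) :
  (forall u v, e u v -> f u != f v) -> (k < #|T|)%N ->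
  exists S : {set T},
    ('C(#|T| - 2, k) * #|edges e| <= 'C(#|T|, k.+1) *
       #|[set p in edges e | (f p.1 \in S) && (f p.2 \notin S)]|)%N.
Proof.
move=> fP kT.
pose cut (S : {set T}) := [set p in edges e | (f p.1 \in S) && (f p.2 \notin S)].
pose P := [pred S : {set T} | #|S| == k.+1].
have cP : #|P| = 'C(#|T|, k.+1).
  by rewrite -card_draws cardsE.
have [S0 PS0] : exists S, S \in P.
  by apply/card_gt0P; rewrite cP bin_gt0.
(* The best [S] does at least as well as the average over [P]. *)
exists [arg max_(S > S0 in P) #|cut S|].
case: arg_maxnP => // S _ maxS.
rewrite -cP -sum_nat_const mulnC -sum_nat_const.
have leS : (\sum_(S' in P) #|cut S'| <= \sum_(S' in P) #|cut S|)%N.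
  by apply: leq_sum => S' /maxS.
apply: leq_trans leS.
under [leqRHS]eq_bigr => S' _ do rewrite -sum1_card.
under [leqRHS]eq_bigr => S' _ do under eq_bigl => p do rewrite inE.
under [leqRHS]eq_bigr => S' _ do rewrite big_mkcondr.
(* Double counting: each edge is cut by all sets separating its two distinct end colours. *)
rewrite exchange_big /=; apply: leq_sum => p; rewrite inE => /fP nep.
apply: leq_trans (card_separating_sets _ nep) _.
by rewrite -big_mkcondr /= -sum1_card; apply/eq_leq/eq_bigl => S'; rewrite !inE.
Qed.

Theorem theorem13 (k : nat) (hk : (1 <= k)%N) (V : finType) (e : rel V)
    (loopless : irreflexive e) (hD : in_Dfam k k e) (hacyc : acyclic e)
    (m : nat) (hm : #|edges e| = m) :
  exists C : {set V * V},
    directed_cut e C /\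
    ((1 / 4 + 1 / (8 * k%:R + 4)) * m%:R <= #|C|%:R :> rat).
Proof.
have [f fP] := proper_coloring hD hacyc.
have cT : #|{: 'I_k.+1 + 'I_k.+1}| = (k.*2).+2 by rewrite card_sum card_ord; lia.
have [|S] := @average_cut V _ e f k fP; first by rewrite cT; lia.
rewrite cT hm subn2 /=.
set C := [set p in _ | _] => avg.
exists C; split.
  exists (f @^-1: S), (~: (f @^-1: S)); split.
  - exact: setUCr.
  - by rewrite disjoints_subset setCK.
  - by apply/setP => p; rewrite !inE.
(* Both sides equal [2 * k.+1 * 'C(k.*2.+1, k)]. *)
have binE : (k.*2.+1.*2 * 'C(k.*2, k) = k.+1 * 'C(k.*2.+2, k.+1))%N.
  rewrite -mul_bin_diag -doubleMl (mul_bin_down k.*2.+1) -doubleS doubleMl.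
  by congr (_.*2 * _)%N; lia.
have B0 : (0 < 'C(k.*2, k))%N by rewrite bin_gt0; lia.
have key : (k.+1 * m <= k.*2.+1.*2 * #|C|)%N.
  rewrite -(leq_pmul2l B0) mulnCA.
  apply: leq_trans (leq_mul (leqnn k.+1) avg) _.
  by rewrite mulnA -binE -mulnA mulnCA.
have k0 : 0 <= k%:R :> rat by [].
have -> : 1 / 4 + 1 / (8 * k%:R + 4) = k.+1%:R / k.*2.+1.*2%:R :> rat.
  rewrite -!mul2n !natrM -!natr1 natrM; field.
  by apply/andP; split; apply: lt0r_neq0; lra.
by rewrite mulrAC ler_pdivrMr ?ltr0n // -!natrM ler_nat [leqRHS]mulnC.
Qed.
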